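(* Let $k\geq1$ and let $M$ be a $k$-matroid of rank $r$. Then for every integer $s$ with $0\leq s< k$, among any $k-s$ pairwise disjoint bases of $M$ at most $r(r+2)!+s(r+1)!$ are not complementary.
   Context: For $k\geq1$, a $k$-matroid is a matroid whose ground set can be partitioned into $k$ pairwise disjoint bases. A basis of a $k$-matroid is complementary if its complement in the ground set can be partitioned into $k-1$ pairwise disjoint bases. *)

(* Defs.v *)
From mathcomp Require Import all_boot.

Set Implicit Arguments.
Unset Strict Implicit.
Unset Printing Implicit Defensive.

Record matroid (T : finType) := Matroid {
  ground : {set T};
  indep : pred {set T};
  indep_ground : forall I : {set T}, indep I -> I \subset ground;
  indep_set0 : indep set0;
  indep_subset : forall I J : {set T}, I \subset J -> indep J -> indep I;
  indep_augment : forall I J : {set T}, indep I -> indep J -> #|I| < #|J| ->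
    exists2 x : T, x \in J :\: I & indep (x |: I)
}.

Section MatroidBases.

Variables (T : finType) (M : matroid T).

Definition basis (B : {set T}) : bool := maxset (indep M) B.

Definition rank : nat := \max_(I : {set T} | indep M I) #|I|.

(* Collections of bases are indexed families rather than sets of sets. The two
   readings differ only in rank 0, where the family may repeat the basis set0. *)
Definition disjoint_bases (n : nat) (B : 'I_n -> {set T}) : bool :=
  [forall i, basis (B i)] &&
  [forall i, forall j, (i != j) ==> [disjoint B i & B j]].

Definition partitions_into_bases (n : nat) (A : {set T}) : bool :=
  [exists B : {ffun 'I_n -> {set T}},
     disjoint_bases B && (\bigcup_(i < n) B i == A)].

Definition k_matroid (k : nat) : bool := partitions_into_bases k (ground M).

Definition complementary (k : nat) (B : {set T}) : bool :=
  basis B && partitions_into_bases k.-1 (ground M :\: B).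

End MatroidBases.

(* Main.v *)
(** By the matroid covering theorem, a basis [B] fails to be complementary only
    if some closed set [F] satisfies [(k-1) rk F < #|F \ B|]. Since
    [#|F| <= k rk F], comparing [#|F|] with the traces of the given disjoint bases
    on [F] shows that one [F] obstructs at most [s (r-1)] of them. Moreover such
    an [F] is spanned by its trace on all but fewer than [r] bases of a fixed
    partition of the ground set into [k] bases, so for large [k] one basis of that
    partition serves [2^r + 1] such [F] at once; having only [2^r] subsets, it
    forces at most [2^r] obstructing [F]. For small [k], the bound exceeds [k]. *)

Require Import Defs.
From mathcomp Require Import all_boot.
From mathcomp Require Import zify.

Set Implicit Arguments.
Unset Strict Implicit.
Unset Printing Implicit Defensive.

(** * Rank function, submodularity and closure *)

Section Rank.

Variables (T : finType) (M : matroid T).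
Implicit Types (A B I J F : {set T}) (x e : T).

Definition rk A : nat := \max_(I : {set T} | indep M I && (I \subset A)) #|I|.

Lemma leq_rk I A : indep M I -> I \subset A -> #|I| <= rk A.
Proof. by move=> iI sIA; apply: leq_bigmax_cond; apply/andP. Qed.

Lemma rk_leq A m :
  (forall I, indep M I -> I \subset A -> #|I| <= m) -> rk A <= m.
Proof. by move=> le_m; apply/bigmax_leqP => I /andP[iI sIA]; apply: le_m. Qed.

Lemma rk_witness A : exists I, [/\ indep M I, I \subset A & #|I| = rk A].
Proof.
have ex0 : 0 < #|[pred I | indep M I && (I \subset A)]|.
  by apply/card_gt0P; exists set0; rewrite inE indep_set0 sub0set.
have [I] := eq_bigmax_cond (fun I : {set T} => #|I|) ex0.
by rewrite inE => /andP[iI sIA] rkE; exists I.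
Qed.

Lemma rk_card A : rk A <= #|A|.
Proof. by apply: rk_leq => I _; apply: subset_leq_card. Qed.

Lemma rkS A B : A \subset B -> rk A <= rk B.
Proof.
by move=> sAB; apply: rk_leq => I iI sIA; apply: leq_rk (subset_trans sIA sAB).
Qed.

Lemma rk_indep I : indep M I -> rk I = #|I|.
Proof. by move=> iI; apply/eqP; rewrite eqn_leq rk_card leq_rk. Qed.

Lemma indep_rk A : #|A| <= rk A -> indep M A.
Proof.
have [I [iI sIA <-]] := rk_witness A => leAI.
by have /eqP <- : I == A by rewrite eqEcard sIA.
Qed.

Lemma indep_extend I A : indep M I -> I \subset A ->
  exists J, [/\ indep M J, I \subset J, J \subset A & #|J| = rk A].
Proof.
move=> iI sIA.
have [J /maxsetP[/andP[iJ sJA] maxJ] sIJ] :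
    {J | maxset [pred J : {set T} | indep M J && (J \subset A)] J & I \subset J}.
  by apply: maxset_exists; rewrite inE iI.
exists J; split=> //; apply/eqP; rewrite eqn_leq leq_rk //= leqNgt.
have [K [iK sKA <-]] := rk_witness A.
apply/negP => /(indep_augment iJ iK)[x]; rewrite inE => /andP[xJ xK] ixJ.
have := maxJ (x |: J); rewrite inE ixJ subUset sub1set (subsetP sKA) // sJA.
by move=> /(_ isT (subsetUr _ _)) eqJ; rewrite -eqJ setU11 in xJ.
Qed.

(** A maximal independent subset [I] of the intersection extends to a maximal one [J] of the union.
    The traces of [J] on [A] and [B] have union [J], and their intersection contains [I]. *)
Lemma rk_submod A B : rk (A :|: B) + rk (A :&: B) <= rk A + rk B.
Proof.
have [I [iI sI <-]] := rk_witness (A :&: B).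
have sIU : I \subset A :|: B.
  by apply: subset_trans sI (subset_trans (subsetIl _ _) (subsetUl _ _)).
have [J [iJ sIJ sJ <-]] := indep_extend iI sIU.
have iJI C : indep M (J :&: C) by apply: indep_subset iJ; apply: subsetIl.
have := leq_add (leq_rk (iJI A) (subsetIr _ _)) (leq_rk (iJI B) (subsetIr _ _)).
apply: leq_trans; rewrite -(cardsUI (J :&: A)) -setIUr (setIidPl sJ) leq_add2l.
by rewrite subset_leq_card // -setIIr subsetI sIJ.
Qed.

Lemma rk_rank A : rk A <= rank M.
Proof.
by apply: rk_leq => I iI _; apply: leq_bigmax_cond.
Qed.

Lemma card_basis B : basis M B -> #|B| = rank M.
Proof.
move=> /maxsetP[iB maxB]; apply/eqP; rewrite eqn_leq.
rewrite (leq_trans (leq_rk iB (subxx B)) (rk_rank B)) /=.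
apply/bigmax_leqP => I iI; rewrite leqNgt; apply/negP.
move=> /(indep_augment iB iI)[x]; rewrite inE => /andP[xB _] ixB.
by rewrite -(maxB _ ixB (subsetUr _ _)) setU11 in xB.
Qed.

Lemma basis_card B : indep M B -> rank M <= #|B| -> basis M B.
Proof.
move=> iB leB; apply/maxsetP; split=> // C iC sBC; apply/eqP.
rewrite eq_sym eqEcard sBC (leq_trans _ leB) //.
exact: leq_trans (leq_rk iC (subxx C)) (rk_rank C).
Qed.

Definition cl A : {set T} := [set x in ground M | rk (x |: A) == rk A].

Lemma cl_ground A : cl A \subset ground M.
Proof. by apply/subsetP=> x; rewrite inE => /andP[]. Qed.

Lemma sub_cl A : A \subset ground M -> A \subset cl A.
Proof.
move=> sAE; apply/subsetP=> x xA; rewrite inE (subsetP sAE) //=.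
by rewrite (setUidPr _) ?sub1set.
Qed.

Lemma rk_cl A : A \subset ground M -> rk (cl A) = rk A.
Proof.
move=> sAE; apply/eqP; rewrite eqn_leq (rkS (sub_cl sAE)) andbT leqNgt.
have [I [iI sIA eI]] := rk_witness A.
have [J [iJ sIJ sJ <-]] := indep_extend iI (subset_trans sIA (sub_cl sAE)).
rewrite -eI; apply/negP => /(indep_augment iI iJ)[x]; rewrite inE.
move=> /andP[xI xJ] ixI; have := subsetP sJ x xJ; rewrite inE => /andP[_ /eqP].
by have := leq_rk ixI (setUS [set x] sIA); rewrite cardsU1 xI; lia.
Qed.

(** Lets a closed set be recovered from any part of it of full rank. *)
Lemma cl_spanning I A : A \subset ground M -> I \subset cl A ->
  rk I = rk A -> cl I = cl A.
Proof.
move=> sAE sIA eI; apply/setP=> x; rewrite !inE.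
case xE: (x \in ground M) => //=; apply/eqP/eqP => ex.
  apply/eqP; rewrite eqn_leq (rkS (subsetUr _ _)) andbT.
  have := rk_submod (x |: I) (cl A); rewrite ex (rk_cl sAE).
  have /rkS : I \subset (x |: I) :&: cl A by rewrite subsetI subsetUr.
  have /rkS : x |: A \subset (x |: I) :|: cl A.
    by rewrite setUAC (subset_trans (setUS _ (sub_cl sAE))) ?subsetUl.
  lia.
apply/eqP; rewrite eqn_leq (rkS (subsetUr _ _)) andbT eI -(rk_cl sAE) rkS //.
by rewrite subUset sIA andbT sub1set inE xE ex eqxx.
Qed.

End Rank.

Lemma predn_mul n m : 0 < n -> n.-1 * m + m = n * m.
Proof. by move=> n_gt0; rewrite -mulSnr prednK. Qed.

Lemma mul_sum_ord n m : n * m = \sum_(i < n) m.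
Proof. by rewrite sum_nat_const card_ord. Qed.

Lemma card_disjoint_bigcup (T I : finType) (C : I -> {set T}) :
  (forall i j, i != j -> [disjoint C i & C j]) ->
  #|\bigcup_i C i| = \sum_i #|C i|.
Proof.
move=> dC; rewrite -sum1_card partition_disjoint_bigcup //.
by apply: eq_bigr => i _; rewrite sum1_card.
Qed.

(** * The matroid covering theorem via minimal colour lists *)

Section Covering.

Variables (T : finType) (M : matroid T) (n : nat) (X : {set T}).
Implicit Types (A : {set T}) (P : {set T * 'I_n}).

Definition fiber P A (c : 'I_n) : {set T} := [set e in A | (e, c) \in P].

(* [P] lists the colours allowed at each element; this is Rado's condition for
   the lists [{e} * {c | (e, c) \in P}] in the direct sum of [n] copies of [M]. *)
Definition rado P : bool :=
  [forall A : {set T}, (A \subset X) ==> (#|A| <= \sum_c rk M (fiber P A c))].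

(** A violator avoiding [e] has the same fibers before the deletion, so it would already violate the
    condition for [P]. *)
Lemma rado_violation P e c : rado P -> ~~ rado (P :\ (e, c)) ->
  exists A, [/\ A \subset X, e \in A &
    \sum_d rk M (fiber (P :\ (e, c)) A d) < #|A|].
Proof.
move=> /forallP radoP /forallPn[A]; rewrite negb_imply -ltnNge => /andP[sAX ltA].
exists A; split=> //; apply: contraLR ltA => eA; rewrite -leqNgt.
apply: leq_trans (implyP (radoP A) sAX) _; apply: leq_sum => d _.
apply/rkS/subsetP=> f; rewrite !inE => /andP[fA ->]; rewrite fA andbT /=.
by apply: contraNneq eA => -[<- _].
Qed.

Lemma minimal_rado_unique P e c1 c2 : minset rado P -> e \in X ->
  (e, c1) \in P -> (e, c2) \in P -> c1 = c2.
Proof.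
move=> /minsetP[radoP minP] eX P1 P2; apply/eqP; apply: contraT => ne12.
have strict c : (e, c) \in P -> ~~ rado (P :\ (e, c)).
  move=> Pc; apply/negP => /minP/(_ (subsetDl _ _)) eqP'.
  by rewrite -eqP' setD11 in Pc.
have [A1 [sA1 eA1 lt1]] := rado_violation radoP (strict _ P1).
have [A2 [sA2 eA2 lt2]] := rado_violation radoP (strict _ P2).
have sAX : A1 :|: A2 \subset X by rewrite subUset sA1.
have sIX : (A1 :&: A2) :\ e \subset X.
  by apply: subset_trans (subsetDl _ _) (subset_trans (subsetIl _ _) sA1).
have leU := implyP (forallP radoP _) sAX.
have leI := implyP (forallP radoP _) sIX.
(* The fibers of the two violators cover those of [A1 :|: A2], since a colour at
   [e] is removed from at most one of them, so submodularity contradicts Rado's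
   condition for [A1 :|: A2] and [(A1 :&: A2) :\ e]. *)
have le_sum : \sum_c rk M (fiber P (A1 :|: A2) c)
    + \sum_c rk M (fiber P ((A1 :&: A2) :\ e) c)
    <= \sum_c rk M (fiber (P :\ (e, c1)) A1 c)
    + \sum_c rk M (fiber (P :\ (e, c2)) A2 c).
  rewrite -!big_split /=; apply: leq_sum => c _.
  apply: leq_trans (rk_submod M _ _); apply: leq_add; apply/rkS/subsetP => f.
    rewrite !inE !xpair_eqE => /andP[fA ->].
    have [-> /=|_ /=] := eqVneq f e; last by rewrite !andbT.
    rewrite eA1 eA2 /= !andbT -negb_and.
    by apply: contra ne12 => /andP[/eqP <- /eqP <-].
  by rewrite !inE !xpair_eqE => /andP[/andP[/negPf -> /andP[-> ->]] ->].
have := cardsUI A1 A2; rewrite (cardsD1 e (A1 :&: A2)) inE eA1 eA2.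
lia.
Qed.

(** With all colours allowed, the hypothesis is Rado's condition. A minimal [P] satisfying it allows
    at most one colour per element, so its fibers are the required classes. *)
Lemma indep_covering :
  (forall A, A \subset X -> #|A| <= n * rk M A) ->
  exists C : 'I_n -> {set T},
    [/\ forall i, indep M (C i),
        forall i j, i != j -> [disjoint C i & C j] &
        \bigcup_(i < n) C i = X].
Proof.
move=> leX.
have radoT : rado setT.
  apply/forallP=> A; apply/implyP=> /leX; congr (_ <= _).
  rewrite (eq_bigr (fun=> rk M A)) ?sum_nat_const ?card_ord // => c _.
  by congr (rk M _); apply/setP=> e; rewrite !inE andbT.
have [P minP _] := minset_exists (P := rado) radoT.
have /minsetP[/forallP radoP _] := minP.
have uniqP := minimal_rado_unique minP.
have fiberX i : fiber P X i \subset X.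
  by apply/subsetP=> e; rewrite inE => /andP[].
exists (fiber P X); split.
- move=> i; apply: (@indep_rk _ M).
  (* By uniqueness of colours, only colour [i] contributes to this sum. *)
  apply: leq_trans (implyP (radoP _) (fiberX i)) _.
  rewrite (bigD1 i) //= big1 => [|c nec].
    by rewrite addn0 rkS //; apply/subsetP=> e; rewrite inE => /andP[].
  apply/eqP; rewrite -leqn0 (leq_trans (rk_card _ _)) // leqn0 cards_eq0.
  apply/eqP/setP=> e; rewrite !inE; apply/negbTE/negP.
  move=> /andP[/andP[eX ei] ec]; by rewrite (uniqP e c i) ?eqxx in nec.
- move=> i j neij; rewrite -setI_eq0; apply/eqP/setP=> e; rewrite !inE.
  apply/negbTE/negP => /andP[/andP[eX ei] /andP[_ ej]].
  by rewrite (uniqP e i j) ?eqxx in neij.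
apply/eqP; rewrite eqEsubset; apply/andP; split; first exact/bigcupsP.
apply/subsetP=> e eX; apply/bigcupP.
have [/exists_inP[c _ Pc]|none] := boolP [exists c in 'I_n, (e, c) \in P].
  by exists c; rewrite // inE eX.
have := implyP (radoP [set e]); rewrite sub1set cards1 => /(_ eX).
rewrite big1 // => c _; apply/eqP; rewrite -leqn0.
rewrite (leq_trans (rk_card _ _)) // leqn0 cards_eq0.
apply/eqP/setP=> f; rewrite !inE; apply/negbTE/negP => /andP[/eqP -> Pc].
by case/negP: none; apply/exists_inP; exists c.
Qed.

(** The covering independent sets have size at most the rank and total size [n * rank M], so each
    bound is an equality. *)
Lemma base_partition :
  #|X| = n * rank M -> (forall A, A \subset X -> #|A| <= n * rk M A) ->
  partitions_into_bases M n X.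
Proof.
move=> cardX /indep_covering[C [iC dC covC]].
have card_C i : rank M <= #|C i|.
  have leC j : #|C j| <= rank M ?= iff (#|C j| == rank M).
    by split=> //; apply: leq_trans (leq_rk (iC j) (subxx _)) (rk_rank M _).
  have [_] := leqif_sum (P := predT) (fun j _ => leC j).
  rewrite -card_disjoint_bigcup // covC cardX sum_nat_const card_ord eqxx.
  by move/esym/forallP/(_ i)/eqP ->.
apply/existsP; exists (finfun C); apply/andP; split.
  apply/andP; split; apply/forallP=> i; first by rewrite ffunE basis_card.
  by apply/forallP=> j; apply/implyP=> neij; rewrite !ffunE dC.
by rewrite -covC; apply/eqP/eq_bigr => i _; rewrite ffunE.
Qed.

End Covering.

(** * Closed sets obstructing complementarity *)

Section KMatroid.

Variables (T : finType) (M : matroid T) (k r : nat) (C : 'I_k -> {set T}).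
Hypotheses (rankM : rank M = r) (disjC : disjoint_bases M C).
Hypothesis (covC : \bigcup_(i < k) C i = ground M).
Implicit Types (A F : {set T}).

Lemma disjoint_basesP n (B : 'I_n -> {set T}) : disjoint_bases M B ->
  (forall i, basis M (B i)) /\ (forall i j, i != j -> [disjoint B i & B j]).
Proof.
case/andP=> /forallP bB /forallP dB; split=> // i j.
exact: implyP (forallP (dB i) j).
Qed.

Lemma card_ground : #|ground M| = k * r.
Proof.
have [bC dC] := disjoint_basesP disjC.
rewrite -covC card_disjoint_bigcup // (eq_bigr (fun=> r)) => [|i _].
  by rewrite sum_nat_const card_ord.
by rewrite (card_basis (bC i)).
Qed.

Lemma card_split A : A \subset ground M -> #|A| = \sum_i #|A :&: C i|.
Proof.
have [bC dC] := disjoint_basesP disjC.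
move=> sAE; rewrite -card_disjoint_bigcup => [|i j /dC].
  by rewrite -big_distrr /= covC (setIidPl sAE).
exact: (disjointW (subsetIr _ _) (subsetIr _ _)).
Qed.

Lemma card_basisI_rk B A : basis M B -> #|A :&: B| <= rk M A.
Proof.
case/maxsetP=> iB _; apply: leq_rk (subsetIl _ _).
exact: indep_subset (subsetIr _ _) iB.
Qed.

Lemma card_leq_rk A : A \subset ground M -> #|A| <= k * rk M A.
Proof.
have [bC _] := disjoint_basesP disjC.
move=> sAE; rewrite card_split // mul_sum_ord.
by apply: leq_sum => i _; apply: card_basisI_rk.
Qed.

(** The rank is that of [F], not of [F :\: B], which makes this stronger than failure of the
    covering condition on [F :\: B]. *)
Definition obstructs B F := k.-1 * rk M F < #|F :\: B|.

(** Otherwise [base_partition] applies to the complement of [B]. A violator [A] there keeps its rank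
    under closure and lies in [cl M A :\: B]. *)
Lemma obstruction B : 0 < k -> basis M B -> ~~ complementary M k B ->
  exists A, A \subset ground M /\ obstructs B (cl M A).
Proof.
move=> k_gt0 bB; rewrite /complementary bB /= => nB.
have [/exists_inP[A sA ltA]|none] :=
    boolP [exists A : {set T} in powerset (ground M :\: B),
             k.-1 * rk M A < #|A|].
  move: sA; rewrite inE subsetD => /andP[sAE dAB]; exists A; split=> //.
  rewrite /obstructs rk_cl // (leq_trans ltA) // subset_leq_card //.
  by rewrite subsetD sub_cl.
case/negP: nB; apply: base_partition => [|A sA]; last first.
  rewrite leqNgt; apply: contra none => ltA.
  by apply/exists_inP; exists A; rewrite // inE.
have /maxsetP[/indep_ground sBE _] := bB.
by rewrite cardsDS // card_ground (card_basis bB) rankM; nia.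
Qed.

(** Each deficient basis costs one unit in #|F| <= k rk F, while obstruction forces #|F| > (k - 1)
    rk F. *)
Lemma few_deficient B F : 0 < k -> F \subset ground M -> obstructs B F ->
  #|[set j | #|F :&: C j| < rk M F]| <= r.
Proof.
move=> k_gt0 sFE obF; have [bC _] := disjoint_basesP disjC.
have leF : #|F| + #|[set j | #|F :&: C j| < rk M F]| <= k * rk M F.
  rewrite card_split // mul_sum_ord -sum1dep_card.
  rewrite [X in _ + X]big_mkcond -big_split /=; apply: leq_sum => j _.
  by case: ltnP; rewrite ?addn1 ?addn0 ?card_basisI_rk.
have := subset_leq_card (subsetDl F B); move: obF (rk_rank M F).
by have := predn_mul (rk M F) k_gt0; rewrite /obstructs rankM; lia.
Qed.

Lemma obstructed_card s (B : 'I_(k - s) -> {set T}) F :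
  s < k -> disjoint_bases M B -> F \subset ground M ->
  #|[set i | obstructs (B i) F]| <= s * r.-1.
Proof.
move=> lt_sk disjB sFE; have [bB dB] := disjoint_basesP disjB.
set U := \bigcup_i B i.
have sUE : U \subset ground M.
  by apply/bigcupsP=> i _; have /maxsetP[/indep_ground] := bB i.
have cardU : #|U| = (k - s) * r.
  rewrite card_disjoint_bigcup // (eq_bigr (fun=> r)) => [|i _].
    by rewrite sum_nat_const card_ord.
  by rewrite (card_basis (bB i)).
have cardFU : #|F :&: U| = \sum_i #|F :&: B i|.
  rewrite -card_disjoint_bigcup => [|i j /dB]; first by rewrite -big_distrr.
  exact: (disjointW (subsetIr _ _) (subsetIr _ _)).
have leFD : #|F :\: U| <= s * r.
  apply: leq_trans (subset_leq_card (setSD U sFE)) _.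
  by rewrite cardsDS // card_ground cardU; nia.
have leF := card_leq_rk sFE.
set n := #|_|.
(* With d = k rk F - #|F|, an obstructed [B i] meets [F] in at most rk F - (d + 1) elements. *)
have le_sum : \sum_i #|F :&: B i| + n * (k * rk M F - #|F|).+1
    <= (k - s) * rk M F.
  rewrite [leqRHS]mul_sum_ord /n -sum_nat_const.
  rewrite [X in _ + X](eq_bigl (fun i => obstructs (B i) F)) => [|i]; last first.
    by rewrite inE.
  rewrite [X in _ + X]big_mkcond -big_split /=; apply: leq_sum => i _.
  case: ifP => [ob|_]; last by rewrite addn0 card_basisI_rk.
  have := predn_mul (rk M F) (leq_ltn_trans (leq0n s) lt_sk).
  by move: ob leF (cardsID (B i) F); rewrite /obstructs; lia.
have [n0|n_gt0] := posnP n; first by rewrite n0.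
have rk_gt0 : 0 < rk M F.
  have /card_gt0P[i] := n_gt0; rewrite inE /obstructs => ob.
  have := subset_leq_card (subsetDl F (B i)); nia.
(* The bounds combine to n + (n - 1) d <= s (r - rk F), where rk F >= 1. *)
have := cardsID U F; rewrite cardFU; have := rk_rank M F; rewrite rankM; nia.
Qed.

Lemma card_bigcup_leq (I : finType) (P : pred I) (D : I -> {set 'I_k}) m :
  (forall i, P i -> #|D i| <= m) -> #|\bigcup_(i | P i) D i| <= #|P| * m.
Proof.
move=> leD; rewrite -sum_nat_const.
elim/big_rec2: _ => [|i n U Pi leU]; first by rewrite cards0.
by rewrite (leq_trans (leq_card_setU _ _).1) // leq_add ?leD.
Qed.

(* When [k] is large, some [C j] is deficient for none of the given closed sets,
   so each of them is the closure of a subset of [C j]. *)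
Lemma few_closures (FF : {set {set T}}) :
  (2 ^ r).+1 * r < k ->
  (forall F, F \in FF ->
     exists A B, [/\ A \subset ground M, F = cl M A & obstructs B F]) ->
  #|FF| <= 2 ^ r.
Proof.
(* [S] lists 2^r + 1 distinct members, one more than a basis has subsets. *)
move=> ltk FFP; rewrite leqNgt; apply/negP => /card_geqP[S [uniqS sizeS sSF]].
have k_gt0 : 0 < k by apply: leq_ltn_trans ltk.
pose D F := [set j | #|F :&: C j| < rk M F].
have cardS : #|mem S| = (2 ^ r).+1 by rewrite -sizeS; apply/card_uniqP.
have : #|\bigcup_(F in mem S) D F| < #|'I_k|.
  rewrite card_ord (leq_ltn_trans _ ltk) // -cardS card_bigcup_leq // => F SF.
  have [A [B [sAE eF obF]]] := FFP F (sSF F SF).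
  by apply: few_deficient obF => //; rewrite eF cl_ground.
rewrite ltnNge => nle.
have [j jD] : exists j, j \notin \bigcup_(F in mem S) D F.
  apply/existsP; apply: contraR nle => /existsPn allD.
  by apply/subset_leq_card/subsetP=> j _; have := allD j; rewrite negbK.
have [bC _] := disjoint_basesP disjC; have /maxsetP[iCj _] := bC j.
have spanS F : F \in S -> F = cl M (F :&: C j).
  move=> SF; have [A [B [sAE eF _]]] := FFP F (sSF F SF).
  rewrite {1}eF; apply/esym/cl_spanning; rewrite -?eF ?subsetIl //.
  rewrite rk_indep ?(indep_subset (subsetIr _ _) iCj) // -(rk_cl sAE) -eF.
  apply/eqP; rewrite eqn_leq card_basisI_rk //= leqNgt.
  by apply: contra jD => ltF; apply/bigcupP; exists F; rewrite ?inE.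
have injS : {in mem S &, injective (fun F => F :&: C j)}.
  by move=> F G SF SG /= eFG; rewrite (spanS F SF) (spanS G SG) eFG.
have : [set F :&: C j | F in mem S] \subset powerset (C j).
  by apply/subsetP=> _ /imsetP[F _ ->]; rewrite inE subsetIr.
move=> /subset_leq_card; rewrite card_in_imset // cardS card_powerset.
by rewrite (card_basis (bC j)) rankM ltnn.
Qed.

End KMatroid.

(** * Powers of two against factorials, and the final count *)

Lemma exp2_leq_fact r : 2 ^ r <= r.+1`!.
Proof. by elim: r => // r IHr; rewrite expnS factS leq_mul. Qed.

Lemma exp2_mul_leq_fact r : r.-1 * 2 ^ r <= r.+1`!.
Proof.
(* The left side vanishes for ranks 0 and 1. With [r] shifted by 2, the inductive step comes down to
   2 (r + 2) <= (r + 4) (r + 1). *)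
case: r => // -[|r] //; elim: r => // r IHr /=.
rewrite factS; apply: leq_trans (leq_mul (leqnn _) IHr).
by rewrite [2 ^ r.+3]expnS !mulnA leq_mul2r /=; apply/orP; right; nia.
Qed.

Theorem theorem3p1 (T : finType) (M : matroid T) (k r s : nat)
    (k_gt0 : 1 <= k) (Mk : k_matroid M k) (rankM : rank M = r) (lt_sk : s < k)
    (B : 'I_(k - s) -> {set T}) (disjB : disjoint_bases M B) :
  #|[set i : 'I_(k - s) | ~~ complementary M k (B i)]|
    <= r * (r + 2)`! + s * (r + 1)`!.
Proof.
have /existsP[C /andP[disjC /eqP covC]] := Mk.
set bad := [set i | _].
(* For small [k] the first summand already exceeds the number of given bases or equals it. *)
have [lek|ltk] := leqP k (r * (r + 2)`!).
  apply: leq_trans (max_card _) _; rewrite card_ord.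
  exact: leq_trans (leq_subr _ _) (leq_trans lek (leq_addr _ _)).
have [bB _] := disjoint_basesP disjB.
pose obs i (A : {set T}) := (A \subset ground M) && obstructs M k (B i) (cl M A).
have obsP i : i \in bad -> exists A, obs i A.
  rewrite inE => nci.
  have [A [sAE obA]] := obstruction rankM disjC covC k_gt0 (bB i) nci.
  by exists A; apply/andP.
(* By [obsP], the default [set0] is never reached at a bad index. *)
pose F i := cl M (odflt set0 [pick A : {set T} | obs i A]).
have FP i : i \in bad ->
    exists A : {set T}, [/\ A \subset ground M, F i = cl M A & obstructs M k (B i) (F i)].
  move=> /obsP[A0 obA0]; rewrite /F; case: pickP => [A /andP[sAE obA]|none].
    by exists A.
  by rewrite none in obA0.
have card_FF : #|F @: bad| <= 2 ^ r.
  apply: (few_closures rankM disjC covC) => [|_ /imsetP[i /FP[A [sAE eF ob]] ->]].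
    (* Here 2^r + 1 <= 2 (r + 1)! <= (r + 2)!. *)
    apply: leq_ltn_trans ltk; rewrite mulnC leq_mul2l; apply/orP; right.
    by rewrite addn2 factS; have := exp2_leq_fact r; have := fact_gt0 r.+1; nia.
  by exists A, (B i).
(* For large [k] the second summand suffices: grouping bad indices by [F i] gives at most 2^r
   groups, each of at most s (r - 1) indices. *)
apply: leq_trans (leq_addl _ _).
rewrite -sum1_card (partition_big_imset F) /=.
apply: leq_trans (_ : \sum_(G in F @: bad) s * r.-1 <= _).
  apply: leq_sum => _ /imsetP[i badi ->].
  rewrite sum1dep_card.
  have [A [_ eF _]] := FP i badi.
  have sFE : F i \subset ground M by rewrite eF cl_ground.
  apply: leq_trans (obstructed_card rankM disjC covC lt_sk disjB sFE).
  apply/subset_leq_card/subsetP=> j; rewrite !inE => /andP[badj /eqP <-].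
  by have [|A' []] := FP j; rewrite ?inE.
rewrite sum_nat_const mulnCA leq_mul2l addn1; apply/orP; right.
by rewrite mulnC (leq_trans _ (exp2_mul_leq_fact r)) ?leq_mul.
Qed.
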